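(* Let $\{X_m\}_{m\in\mathbb{Z}}$ be a stationary process and let $A\in\mathcal{C}^n$. Assume that there are a real number $\rho(A)\in[0,1)$ and a sequence $(d_i(A))_{i\ge1}$ converging to $0$ such that $|\rho_i(A)-\rho(A)|\le d_i(A)$ for all $i\ge1$, and put $\overline{d}(A)=\sup\{d_i(A): i\ge1\}$. Let $c(A)\in[0,1)$ be a constant such that for all integers $k\ge0$ $$\left|\mathbb{P}_A(S_A=k)-(1-\rho(A))\rho(A)^k\right|\le c(A)^k\sum_{i=1}^{k+1}d_i(A)\le c(A)^k(k+1)\,\overline{d}(A).$$ Let $Y$ be a random variable with geometric distribution with parameter $\rho(A)$, i.e. $P(Y=k)=(1-\rho(A))\rho(A)^k$ for integers $k\ge0$, and let $\beta>0$. Then $$\left|\mathbb{E}_A(S_A^\beta)-\mathbb{E}(Y^\beta)\right|\le 2\,\overline{d}(A)\sum_{k=1}^{\infty}k^{\beta+1}c(A)^k.$$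
   Context: Setting: $\mathcal{C}$ is a finite set, $\Omega=\mathcal{C}^{\mathbb{Z}}$, $X_m:\Omega\to\mathcal{C}$ is the $m$-th coordinate projection, $T:\Omega\to\Omega$ is the left shift, $(T(x))_m=x_{m+1}$. $\mathbb{P}$ is a $T$-invariant probability measure on the product $\sigma$-algebra, with no singleton (symbol) of probability $0$. Write $\mathbb{P}_V(W)=\mathbb{P}(W\mid V)$ and $\mathbb{E}_V$ for the conditional mean given $V$. The notation $A\in\mathcal{C}^n$ (an $n$-string) means $A=\{X_0=a_0,\dots,X_{n-1}=a_{n-1}\}$ with $a_i\in\mathcal{C}$. Period: $\tau(A)=\min\{k\in\{1,\dots,n\}: A\cap T^{-k}(A)\neq\emptyset\}$. Sojourn time: $S_A(x)=\sup\{k\ge 1: x\in A\cap T^{-j\tau(A)}A\ \text{for all } j=1,\dots,k\}$, with $S_A(x)=0$ if the supremum is over the empty set. For $i\ge1$, $\rho_i(A)=\mathbb{P}\big(A\,\big|\,\bigcap_{j=1}^{i}T^{j\tau(A)}A\big)$ (the conditioning events having positive probability, so that these quantities are defined; likewise $\mathbb{P}(A)>0$). Convention: $0^0=1$. *)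

(* Defs.v *)
From mathcomp Require Export all_boot all_order all_algebra.
From mathcomp Require Export all_classical all_reals all_analysis.
Export Order.TTheory GRing.Theory Num.Theory.
Export numFieldNormedType.Exports.

Set Implicit Arguments.
Unset Strict Implicit.
Unset Printing Implicit Defensive.

Local Open Scope classical_set_scope.
Local Open Scope ring_scope.

(* The alphabet is a [pointedType] (later assumed finite) because the library's
   measurable spaces are pointed; C^Z carries a probability measure only if
   the alphabet is nonempty, so this is no restriction. *)
Section Sequences.
Variable C : pointedType.

Definition Xcoord (m : int) (x : int -> C) : C := x m.

(* The alphabet carries the discrete sigma-algebra. *)
Definition Xcoord_events : set (set (int -> C)) :=
  [set E | exists (m : int) (B : set C), E = Xcoord m @^-1` B].

(* C^Z with the product sigma-algebra. *)
Definition Omega := g_sigma_algebraType Xcoord_events.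

Definition left_shift (x : Omega) : Omega := fun m : int => x (m + 1).

Definition shift_preim (k : nat) (E : set Omega) : set Omega :=
  iter k left_shift @^-1` E.

Definition shift_im (k : nat) (E : set Omega) : set Omega :=
  iter k left_shift @` E.

Definition cylinder (n : nat) (a : n.-tuple C) : set Omega :=
  [set x | forall i : 'I_n, Xcoord (nat_of_ord i)%:Z x = tnth a i].

(* The minimum over k in {1, ..., n}; for n >= 1 the default value n is itself
   admissible, since a string can always be followed by a copy of itself. *)
Definition period (n : nat) (a : n.-tuple C) : nat :=
  \big[minn/n]_(1 <= k < n.+1 |
    `[< cylinder a `&` shift_preim k (cylinder a) !=set0 >]) k.

Section Sojourn.
Variables (R : realType) (n : nat) (a : n.-tuple C).

Definition sojourn_set (x : Omega) : set nat :=
  [set k | (1 <= k)%N /\ forall j : nat, (1 <= j <= k)%N ->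
     (cylinder a `&` shift_preim (j * period a) (cylinder a)) x].

(* Takes values in {0, 1, 2, ...} together with +oo. *)
Definition sojourn (x : Omega) : \bar R :=
  if `[< sojourn_set x !=set0 >]
  then ereal_sup [set k%:R%:E | k in sojourn_set x]
  else 0%E.

End Sojourn.

Definition return_event (n : nat) (a : n.-tuple C) (i : nat) : set Omega :=
  \bigcap_(j in [set j : nat | (1 <= j <= i)%N])
    shift_im (j * period a) (cylinder a).

Definition shift_invariant (R : realType) (P : probability Omega R) : Prop :=
  forall B : set Omega, measurable B -> P (left_shift @^-1` B) = P B.

End Sequences.

Section Conditioning.
Context d (T : measurableType d) (R : realType) (P : probability T R).

Definition cond_prob (V W : set T) : R := fine (P (W `&` V)) / fine (P V).

Definition cond_mean (V : set T) (f : T -> \bar R) : \bar R :=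
  ((\int[P]_(x in V) f x) * ((fine (P V))^-1)%:E)%E.

End Conditioning.

Definition return_prob (C : pointedType) (R : realType) (P : probability (Omega C) R)
    (n : nat) (a : n.-tuple C) (i : nat) : R :=
  cond_prob P (return_event a i) (cylinder a).

Definition geometric_rv d (T : measurableType d) (R : realType)
    (Q : probability T R) (Y : {RV Q >-> R}) (r : R) : Prop :=
  forall k : nat, Q [set w | Y w = k%:R] = ((1 - r) * r ^+ k)%:E.

(* Main.v *)
Require Import Defs.
From mathcomp Require Import measurable_realfun ring lra zify.

(** Conditionally on [A], the sojourn time is at least [k] exactly on the run
    event [repeats a t k], that [A] recurs at each of the times [0, t, ..., k t],
    where [t] is the period. Write [q k] for its probability. Shifting the
    conditioning events of [rho_i] to the right by [i t] turns them into run
    events, so stationarity gives [rho_i = q i / q (i - 1)] ([return_probE]).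

    This yields that the sojourn time is almost surely finite: the sequence [q]
    decreases to the probability [L] of an infinite run, and letting [i] go to
    infinity in [q i = rho_i * q (i - 1)] gives [L = rho L], hence [L = 0] since
    [rho < 1] ([infinite_repeats_null]). Therefore the conditional mean of
    [S ^ beta] is the series of [k ^ beta * P_A (S = k)]
    ([cond_mean_sojourn]), in the same way as the mean of [Y ^ beta] is the
    series of [k ^ beta * (1 - rho) rho ^ k] ([expectation_geometric_powR]).

    The two series are compared term by term. The second one converges, because
    a geometric factor beats any power, so the distance between the sums is at
    most the sum of the distances ([nneseries_dist]), each of which is at most
    [k ^ beta * c ^ k * (k + 1) * dbar]. The term [k = 0] vanishes since
    [beta > 0], and for [k >= 1] the bound [k + 1 <= 2 k] produces the factor
    [2] and the exponent [beta + 1]. *)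

Set Implicit Arguments.
Unset Strict Implicit.
Unset Printing Implicit Defensive.

Local Open Scope classical_set_scope.
Local Open Scope ring_scope.

(** * Integrals of functions with countably many values, and series *)

(** The sets [F k] need only cover [D] up to a null set: the sojourn time may be
    infinite, and a geometric variable may take other values, each time with
    probability zero. *)
Lemma integral_countable_values d (T : measurableType d) (R : realType)
    (mu : measure T R) (D : set T) (f : T -> \bar R)
    (F : nat -> set T) (v : nat -> \bar R) :
  measurable D -> measurable_fun D f -> (forall x, D x -> (0 <= f x)%E) ->
  (forall k, measurable (F k)) -> (forall k, F k `<=` D) ->
  trivIset setT F -> mu (D `\` \bigcup_k F k) = 0 ->
  (forall k x, F k x -> f x = v k) ->
  (\int[mu]_(x in D) f x = \sum_(0 <= k <oo) v k * mu (F k))%E.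
Proof.
move=> mD mf f0 mF FD tF N0 fv.
have mU : measurable (\bigcup_k F k) by exact: bigcup_measurable.
have UD : \bigcup_k F k `<=` D by move=> x [k _ /FD].
have mN : measurable (D `\` \bigcup_k F k) by exact: measurableD.
have DE : D = \bigcup_k F k `|` (D `\` \bigcup_k F k).
  by rewrite setDUK.
rewrite {1}DE ge0_integral_setU //; first last.
- by apply/disj_setPS => x [] h [].
- by move=> x; rewrite -DE; exact: f0.
- by rewrite -DE.
rewrite [X in (_ + X)%E]null_set_integral //; last first.
  by apply: measurable_funS mf.
rewrite adde0 ge0_integral_bigcup //; first last.
- by move=> x /UD /f0.
- exact: measurable_funS mf.
apply: eq_eseriesr => k _.
rewrite (eq_integral (cst (v k))); first by rewrite integral_cst.
by move=> x; rewrite inE => /fv.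
Qed.

Lemma nneseries_geometric (R : realType) (s : R) : 0 <= s < 1 ->
  (\sum_(0 <= k <oo) (s ^+ k)%:E = ((1 - s)^-1)%:E)%E.
Proof.
move=> /andP[s0 s1]; apply: cvg_lim => //.
under eq_fun do rewrite sumEFin.
apply: cvg_EFin; first by near=> n.
rewrite -[X in _ --> X]div1r.
apply: cvg_trans; last first.
  by apply: (@cvg_geometric_series R 1 s); rewrite ger0_norm.
apply: near_eq_cvg; near=> n => /=.
rewrite /series /=; apply: eq_bigr => i _; by rewrite /= mul1r.
Unshelve. all: by end_near. Qed.

(** With [t = - ln s] and [u = k t / b], the inequality [u <= expR u] raised to
    the power [b] reads [(k t / b) ^ b <= s ^ (- k)], which gives the bound
    [(b / t) ^ b]. *)
Lemma powR_geometric_bounded (R : realType) (b s : R) : 0 < b -> 0 < s < 1 ->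
  exists2 M : R, 0 <= M & forall k : nat, k%:R `^ b * s ^+ k <= M.
Proof.
move=> b0 /andP[s0 s1].
pose t := - ln s.
have t0 : 0 < t by rewrite oppr_gt0 ln_lt0// s0.
exists ((b / t) `^ b); first exact: powR_ge0.
move=> k; pose u := k%:R * t / b.
have u0 : 0 <= u by rewrite /u divr_ge0 ?(ltW b0)// mulr_ge0// ltW.
have -> : k%:R = b / t * u by rewrite /u; field; rewrite !gt_eqF.
rewrite powRM//; last by rewrite divr_ge0 ?ltW.
rewrite -mulrA ler_piMr ?powR_ge0//.
have -> : s ^+ k = expR (- u) `^ b.
  rewrite -expRM -{1}[s]lnK ?posrE// -expRM_natl; congr expR.
  by rewrite /u /t; field; rewrite gt_eqF.
have e1 : 1 `^ b = 1 :> R by rewrite powR1.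
rewrite -powRM ?expR_ge0// -[leRHS]e1.
apply: ge0_ler_powR; rewrite ?nnegrE ?(ltW b0)//.
  by rewrite mulr_ge0 ?expR_ge0.
rewrite expRN ler_pdivrMr ?expR_gt0// mul1r.
by apply: le_trans (expR_ge1Dx u); rewrite lerDr.
Qed.

(** Half of the geometric decay is spent on bounding the power of [k], the other
    half makes the series converge: [s = (1 + r) / 2] satisfies [r <= s ^ 2] and
    [s < 1]. *)
Lemma nneseries_powR_geometric_lty (R : realType) (b r : R) :
  0 < b -> 0 <= r < 1 ->
  (\sum_(0 <= k <oo) (k%:R `^ b * r ^+ k)%:E < +oo)%E.
Proof.
move=> b0 /andP[r0 r1]; pose s := (1 + r) / 2.
have s01 : 0 < s < 1 by apply/andP; split; rewrite /s; lra.
have [s0 s1] := andP s01.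
have rs : r <= s * s by rewrite /s; nra.
have [M M0 hM] := powR_geometric_bounded b0 s01.
apply: (@le_lt_trans _ _ (\sum_(0 <= k <oo) (M%:E * (s ^+ k)%:E))%E).
  apply: lee_nneseries => [k _ _|k _].
    by rewrite lee_fin mulr_ge0 ?powR_ge0// exprn_ge0.
  rewrite -EFinM lee_fin.
  apply: (@le_trans _ _ (k%:R `^ b * (s ^+ k * s ^+ k))).
    by rewrite ler_wpM2l ?powR_ge0// -exprMn lerXn2r// nnegrE mulr_ge0// ltW.
  by rewrite mulrA ler_wpM2r// exprn_ge0// ltW.
rewrite nneseriesZl; last by move=> k _; rewrite lee_fin exprn_ge0// ltW.
by rewrite nneseries_geometric ?(ltW s0)// -EFinM ltry.
Qed.

(** Only the series of [v] has to converge. If that of [u] diverges, then so does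
    that of [w], since [u k <= v k + w k]; this is what makes the moment of the
    sojourn time finite whenever the final bound is. *)
Lemma nneseries_dist (R : realType) (u v w : nat -> R) :
  (forall k, 0 <= u k) -> (forall k, 0 <= v k) ->
  (forall k, `|u k - v k| <= w k) ->
  (\sum_(0 <= k <oo) (v k)%:E < +oo)%E ->
  (`| \sum_(0 <= k <oo) (u k)%:E - \sum_(0 <= k <oo) (v k)%:E |
    <= \sum_(0 <= k <oo) (w k)%:E)%E.
Proof.
move=> u0 v0 uvw vfin.
have w0 k : 0 <= w k by exact: le_trans (uvw k).
have H (x y : nat -> R) : (forall k, 0 <= x k) -> (forall k, 0 <= y k) ->
    (forall k, `|x k - y k| <= w k) ->
    (\sum_(0 <= k <oo) (x k)%:E <=
       \sum_(0 <= k <oo) (y k)%:E + \sum_(0 <= k <oo) (w k)%:E)%E.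
  move=> x0 y0 xyw.
  rewrite -nneseriesD; try by move=> *; rewrite lee_fin.
  apply: lee_nneseries => [k _ _|k _]; first by rewrite lee_fin.
  rewrite -EFinD lee_fin -lerBlDl; exact: le_trans (ler_norm _) (xyw k).
have uv := H u v u0 v0 uvw.
have vu : (\sum_(0 <= k <oo) (v k)%:E <=
       \sum_(0 <= k <oo) (u k)%:E + \sum_(0 <= k <oo) (w k)%:E)%E.
  by apply: H => // k; rewrite distrC.
have V0 : (0 <= \sum_(0 <= k <oo) (v k)%:E)%E.
  by apply: nneseries_ge0 => *; rewrite lee_fin.
have U0 : (0 <= \sum_(0 <= k <oo) (u k)%:E)%E.
  by apply: nneseries_ge0 => *; rewrite lee_fin.
move: uv vu vfin V0 U0.
move: (\sum_(0 <= k <oo) (v k)%:E)%E => [V| |] //.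
move: (\sum_(0 <= k <oo) (w k)%:E)%E => [W| |] //;
  move: (\sum_(0 <= k <oo) (u k)%:E)%E => [U| |] //=.
  rewrite -!EFinD !lee_fin => UVW VUW _ _ _.
  by rewrite ler_norml; apply/andP; split; lra.
by move=> *; rewrite leey.
Qed.

(** * The shift and the run events *)

Lemma iter_left_shiftE (C : pointedType) (k : nat) (x : Omega C) (m : int) :
  iter k (@left_shift C) x m = x (m + k%:Z).
Proof.
elim: k m => [|k IH] m /=; first by rewrite addr0.
by rewrite /left_shift IH; congr (x _); lia.
Qed.

Lemma measurable_left_shift (C : pointedType) :
  measurable_fun setT (@left_shift C).
Proof.
apply: (@measurability _ _ (Omega C) (Omega C) _ _ (@Xcoord_events C) erefl).
move=> _ [_ [m [B ->]] <-]; rewrite setTI.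
by apply: sub_sigma_algebra; exists (m + 1), B.
Qed.

Lemma shift_invariant_iter (C : pointedType) (R : realType)
    (P : probability (Omega C) R) : shift_invariant P ->
  forall (k : nat) (B : set (Omega C)), measurable B ->
  P (iter k (@left_shift C) @^-1` B) = P B.
Proof.
move=> Pinv; elim=> [|k IH] B mB; first by [].
rewrite -(Pinv B mB) -[RHS]IH //.
by rewrite -[X in measurable X]setTI; exact: measurable_left_shift.
Qed.

(** All events of the problem are intersections of translates of the cylinder,
    to the right as well as to the left; one family indexed by a position in the
    integers contains them all, and the shift acts on it by translation. *)
Definition word_at (C : pointedType) (n : nat) (a : n.-tuple C) (p : int) :
    set (Omega C) :=
  [set x | forall i : 'I_n, x (p + (nat_of_ord i)%:Z) = tnth a i].

Definition repeats (C : pointedType) (n : nat) (a : n.-tuple C) (t k : nat) :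
    set (Omega C) :=
  [set x | forall j : nat, (j <= k)%N -> word_at a (j * t)%N%:Z x].

Lemma measurable_word_at (C : pointedType) (n : nat) (a : n.-tuple C)
    (p : int) : measurable (word_at a p).
Proof.
have -> : word_at a p = \bigcap_(i in [set: 'I_n])
    (@Xcoord C (p + (nat_of_ord i)%:Z) @^-1` [set tnth a i]).
  by apply/seteqP; split => x h i; [move=> _; exact: h | exact: (h i I)].
apply: fin_bigcap_measurable; first exact: finite_finset.
by move=> i _; apply: sub_sigma_algebra; do 2 eexists.
Qed.

Lemma cylinderE (C : pointedType) (n : nat) (a : n.-tuple C) :
  cylinder a = word_at a 0.
Proof. by apply/seteqP; split => x h i; have := h i; rewrite /Xcoord add0r. Qed.

Lemma preim_word_at (C : pointedType) (n : nat) (a : n.-tuple C)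
    (k : nat) (p : int) :
  iter k (@left_shift C) @^-1` word_at a p = word_at a (p + k%:Z).
Proof.
by apply/seteqP; split => x h i; have := h i; rewrite /= iter_left_shiftE addrAC.
Qed.

(** Direct images need the shift to be onto: the preimage of [x] is its
    translate in the other direction. *)
Lemma im_word_at (C : pointedType) (n : nat) (a : n.-tuple C)
    (k : nat) (p : int) :
  iter k (@left_shift C) @` word_at a p = word_at a (p - k%:Z).
Proof.
apply/seteqP; split => [_ [y h <-] i|x h].
  by rewrite iter_left_shiftE -(h i); congr (y _); lia.
exists (fun m => x (m - k%:Z)).
  by move=> i; rewrite -(h i); congr (x _); lia.
by apply/funext => m; rewrite iter_left_shiftE; congr (x _); lia.
Qed.

Lemma measurable_repeats (C : pointedType) (n : nat) (a : n.-tuple C)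
    (t k : nat) : measurable (repeats a t k).
Proof.
rewrite (_ : repeats a t k =
  \bigcap_(j in [set j | (j <= k)%N]) word_at a (j * t)%N%:Z)//.
by apply: bigcap_measurableType => j _; exact: measurable_word_at.
Qed.

Lemma repeats0 (C : pointedType) (n : nat) (a : n.-tuple C) t :
  repeats a t 0 = cylinder a.
Proof.
rewrite cylinderE; apply/seteqP; split => x h.
  by have := h 0%N (leqnn _); rewrite mul0n.
by case=> // _; rewrite mul0n.
Qed.

Lemma le_repeats (C : pointedType) (n : nat) (a : n.-tuple C) t k l :
  (k <= l)%N -> repeats a t l `<=` repeats a t k.
Proof. by move=> kl x h j jk; apply: h; exact: leq_trans jk kl. Qed.

Lemma return_eventE (C : pointedType) (n : nat) (a : n.-tuple C) i :
  return_event a i =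
  [set x | forall j, (1 <= j <= i)%N -> word_at a (- (j * period a)%N%:Z) x].
Proof.
apply/seteqP; split => x h j ji.
  by have := h j ji; rewrite /shift_im cylinderE im_word_at sub0r.
by rewrite /shift_im cylinderE im_word_at sub0r; exact: h.
Qed.

Lemma measurable_return_event (C : pointedType) (n : nat) (a : n.-tuple C) i :
  measurable (return_event a i).
Proof.
rewrite return_eventE.
by apply: bigcap_measurableType => j _; exact: measurable_word_at.
Qed.

(** The shift by [(i + 1) t] moves the occurrence at time [- j t] to the time
    [(i + 1 - j) t], so the conditioning event of [rho_(i + 1)] becomes a run of
    [i] repetitions, its positions being listed in reverse order. *)
Lemma preim_return_event (C : pointedType) (n : nat) (a : n.-tuple C) i :
  iter (i.+1 * period a) (@left_shift C) @^-1` return_event a i.+1 =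
  repeats a (period a) i.
Proof.
rewrite return_eventE; apply/seteqP; split => x h j ji.
  have := h (i.+1 - j)%N; rewrite -[word_at _ _ _]/((_ @^-1` word_at _ _) x).
  rewrite preim_word_at => /(_ _).
  rewrite (_ : - _ + _ = (j * period a)%N%:Z); first by apply; lia.
  by rewrite mulnBl; nia.
rewrite -[word_at _ _ _]/((_ @^-1` word_at _ _) x) preim_word_at.
rewrite (_ : - _ + _ = ((i.+1 - j) * period a)%N%:Z); first by apply: h; lia.
by rewrite mulnBl; nia.
Qed.

Lemma preim_cylinder_return_event (C : pointedType) (n : nat)
    (a : n.-tuple C) i :
  iter (i.+1 * period a) (@left_shift C) @^-1`
    (cylinder a `&` return_event a i.+1) =
  repeats a (period a) i.+1.
Proof.
rewrite preimage_setI preim_return_event cylinderE preim_word_at add0r.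
apply/seteqP; split => [x [h1 h2] j|x h].
  by rewrite leq_eqVlt => /predU1P[->//|ji]; apply: h2.
by split; [exact: h | exact: le_repeats h].
Qed.

Lemma return_probE (C : pointedType) (n : nat) (a : n.-tuple C)
    (R : realType) (P : probability (Omega C) R) i :
  shift_invariant P ->
  return_prob P a i.+1 =
    fine (P (repeats a (period a) i.+1)) / fine (P (repeats a (period a) i)).
Proof.
move=> Pinv; rewrite /return_prob /cond_prob -preim_cylinder_return_event.
rewrite -preim_return_event !shift_invariant_iter//.
  exact: measurable_return_event.
apply: measurableI; last exact: measurable_return_event.
by rewrite -(repeats0 a 0); exact: measurable_repeats.
Qed.

(** * The sojourn time *)

(** The condition for [j = 1] already contains the occurrence of the word at time
    zero, which is the position [j = 0] of a run. *)
Lemma sojourn_setE (C : pointedType) (n : nat) (a : n.-tuple C) (x : Omega C) :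
  sojourn_set a x = [set k | (1 <= k)%N /\ repeats a (period a) k x].
Proof.
apply/seteqP; split => k [k1 h]; split=> //.
  case=> [_|j jk].
    have [+ _] := h 1%N (introT andP (conj isT k1)).
    by rewrite cylinderE mul0n.
  have [_] := h j.+1 jk.
  by rewrite /shift_preim cylinderE preim_word_at add0r.
move=> j /andP[_ jk]; rewrite /shift_preim cylinderE preim_word_at add0r.
by split; [have := h 0%N (leq0n _); rewrite mul0n | exact: h].
Qed.

Lemma sojourn_nat (C : pointedType) (n : nat) (a : n.-tuple C)
    (R : realType) (x : Omega C) k :
  repeats a (period a) k x -> ~ repeats a (period a) k.+1 x ->
  sojourn R a x = k%:R%:E.
Proof.
move=> hk hk1; rewrite /sojourn sojourn_setE.
have lek m : repeats a (period a) m x -> (m <= k)%N.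
  move=> hm; rewrite leqNgt; apply/negP => km.
  by apply: hk1; exact: le_repeats hm.
case: asboolP => [[m0 [m01 /lek m0k]]|ne].
  apply/eqP; rewrite eq_le; apply/andP; split.
    apply: ge_ereal_sup => _ [m [_ /lek mk] <-].
    by rewrite lee_fin ler_nat.
  by apply: ereal_sup_ubound; exists k => //; split=> //; exact: leq_trans m0k.
case: k {hk1} hk lek ne => // k hk _ ne; exfalso; apply: ne.
by exists k.+1.
Qed.

Lemma sojourn_oo (C : pointedType) (n : nat) (a : n.-tuple C)
    (R : realType) (x : Omega C) :
  (forall k, repeats a (period a) k x) -> sojourn R a x = +oo%E.
Proof.
move=> h; rewrite /sojourn sojourn_setE; case: asboolP => [_|ne]; last first.
  by exfalso; apply: ne; exists 1%N.
apply/eqyP => r r0; apply: (@le_trans _ _ (Num.bound r).+1%:R%:E).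
  by rewrite lee_fin ltW// (lt_trans (archi_boundP (ltW r0)))// ltr_nat.
by apply: ereal_sup_ubound; exists (Num.bound r).+1.
Qed.

Lemma exists_last_repeat (C : pointedType) (n : nat) (a : n.-tuple C)
    (x : Omega C) : cylinder a x ->
  (forall k, repeats a (period a) k x) \/
  exists k, repeats a (period a) k x /\ ~ repeats a (period a) k.+1 x.
Proof.
rewrite -(repeats0 a (period a)) => x0.
have [|ne] := pselect (exists k,
    repeats a (period a) k x /\ ~ repeats a (period a) k.+1 x); first by right.
left; elim=> // k IH.
by apply: contrapT => hk; apply: ne; exists k.
Qed.

Lemma sojourn_eqE (C : pointedType) (n : nat) (a : n.-tuple C)
    (R : realType) k :
  [set x | sojourn R a x = k%:R%:E] `&` cylinder a =
  repeats a (period a) k `\` repeats a (period a) k.+1.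
Proof.
apply/seteqP; split => x.
  move=> [/= xk /exists_last_repeat[/(sojourn_oo R)|[m [hm hm1]]]].
    by rewrite xk.
  have := sojourn_nat R hm hm1; rewrite xk => -[] /eqP.
  by rewrite eqr_nat => /eqP ->.
move=> [hk hk1]; split; first exact: sojourn_nat.
by rewrite -(repeats0 a (period a)); exact: le_repeats hk.
Qed.

(** The probabilities [q k] of the runs decrease to the probability [L] of the
    infinite run, while their successive ratios tend to [rho]; thus [L = rho L],
    which forces [L = 0] as [rho < 1]. *)
Lemma infinite_repeats_null (C : pointedType) (R : realType)
    (P : probability (Omega C) R) (n : nat) (a : n.-tuple C)
    (rho : R) (d : nat -> R) :
  shift_invariant P ->
  (forall i, (1 <= i)%N -> (0 < P (return_event a i))%E) ->
  rho < 1 -> d @ \oo --> (0 : R) ->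
  (forall i, (1 <= i)%N -> `|return_prob P a i - rho| <= d i) ->
  P (\bigcap_k repeats a (period a) k) = 0.
Proof.
move=> Pinv Pret rho1 d0 rho_d.
set r := repeats a (period a).
pose q k := fine (P (r k)).
have mr k : measurable (r k) by exact: measurable_repeats.
have mcap : measurable (\bigcap_k r k) by exact: bigcapT_measurable.
have q0 k : 0 < q k.
  rewrite /q fine_gt0// /r -preim_return_event shift_invariant_iter//.
    by rewrite Pret//= ltey_eq fin_num_measure//; exact: measurable_return_event.
  exact: measurable_return_event.
have q1 k : q k <= 1.
  by rewrite /q -lee_fin fineK ?fin_num_measure// probability_le1.
pose L := fine (P (\bigcap_k r k)).
have qL : q @ \oo --> L.
  apply: fine_cvg; rewrite fineK ?fin_num_measure//.
  apply: nonincreasing_cvg_mu => //.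
    by rewrite ltey_eq fin_num_measure.
  move=> k l kl; apply/subsetPset; exact: le_repeats.
have qS : (fun k => q k.+1) @ \oo --> L by rewrite cvg_shiftS.
have dS : (fun k => d k.+1) @ \oo --> (0 : R) by rewrite cvg_shiftS.
(* The ratios are avoided, as [L] may not be divided by: the limit is taken in
   [|q (k + 1) - rho q k| <= d (k + 1)]. *)
have lim1 : (fun k => `|q k.+1 - rho * q k|) @ \oo --> `|L - rho * L|.
  by apply: cvg_norm; apply: cvgB => //; apply: cvgMr.
have : `|L - rho * L| <= 0.
  apply: ler_cvg_to lim1 dS _; near=> k.
  have -> : q k.+1 = return_prob P a k.+1 * q k.
    rewrite return_probE// -[fine (P (repeats _ _ k))]/(q k).
    by rewrite divfK ?gt_eqF.
  rewrite -mulrBl normrM (gtr0_norm (q0 k)).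
  apply: le_trans (rho_d k.+1 isT).
  by rewrite ler_piMr.
rewrite normr_le0 subr_eq0 => /eqP LE.
have L0 : L = 0 by nra.
by rewrite -[LHS]fineK ?fin_num_measure// -/L L0.
Unshelve. all: by end_near. Qed.

(** The levels [S = k] partition the cylinder up to the infinite run, on which
    the sojourn time is infinite; that run being null, it does not contribute. *)
Lemma cond_mean_sojourn (C : pointedType) (R : realType)
    (P : probability (Omega C) R) (n : nat) (a : n.-tuple C) (b : R) :
  P (\bigcap_k repeats a (period a) k) = 0 ->
  cond_mean P (cylinder a) (fun x => sojourn R a x `^ b)%E =
  (\sum_(0 <= k <oo)
     (k%:R `^ b *
      cond_prob P (cylinder a) [set x | sojourn R a x = k%:R%:E])%:E)%E.
Proof.
set r := repeats a (period a) => Pcap.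
have mr k : measurable (r k) by exact: measurable_repeats.
have mcap : measurable (\bigcap_k r k) by exact: bigcapT_measurable.
pose F k := r k `\` r k.+1.
have mF k : measurable (F k) by exact: measurableD.
have FA k : F k `<=` cylinder a.
  by rewrite -(repeats0 a (period a)) => x [hk _]; exact: le_repeats hk.
have Ff k x : F k x -> (sojourn R a x `^ b)%E = (k%:R `^ b)%:E.
  by move=> [hk hk1]; rewrite (sojourn_nat R hk hk1).
have AE : cylinder a `\` \bigcup_k F k = \bigcap_k r k.
  apply/seteqP; split => x.
    move=> [/exists_last_repeat[h _ k _|[k hk]]]; first exact: h.
    by case; exists k.
  move=> h; split; first by rewrite -(repeats0 a (period a)); exact: h.
  by move=> [k _ [_]]; apply; exact: h.
have mA : measurable (cylinder a).
  by rewrite -(repeats0 a (period a)); exact: mr.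
have mf : measurable_fun (cylinder a) (fun x => sojourn R a x `^ b)%E.
  have -> : cylinder a = (\bigcap_k r k) `|` \bigcup_k F k.
    rewrite -AE setUC setDUK// => x [k _]; exact: FA.
  apply/measurable_funU => //; first exact: bigcup_measurable.
  split.
    apply: (eq_measurable_fun (cst (+oo `^ b)%E)) => //.
    by move=> x; rewrite inE => h /=; rewrite sojourn_oo// => k; exact: h.
  apply/measurable_fun_bigcup => // k.
  apply: (eq_measurable_fun (cst (k%:R `^ b)%:E)) => //.
  by move=> x; rewrite inE => /Ff.
rewrite /cond_mean (integral_countable_values mA mf _ mF FA _ _ Ff).
- rewrite muleC -nneseriesZl; last first.
    by move=> k _; rewrite mule_ge0// lee_fin powR_ge0.
  apply: eq_eseriesr => k _.
  rewrite /cond_prob sojourn_eqE -/r -/(F k).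
  rewrite -[X in (_ * (_ * X))%E]fineK ?fin_num_measure// -!EFinM; congr EFin.
  by rewrite mulrC mulrA.
- by move=> x _; exact: poweR_ge0.
- apply: ltn_trivIset => k l kl; apply/seteqP; split => // x [[_ hk] [hl _]].
  by apply: hk; exact: le_repeats hl.
- by rewrite AE.
Qed.

(** The prescribed point masses sum to one, which confines [Y] to the natural
    numbers almost surely. *)
Lemma expectation_geometric_powR (disp : measure_display)
    (T : measurableType disp) (R : realType) (Q : probability T R)
    (Y : {RV Q >-> R}) (rho b : R) :
  0 <= rho < 1 -> geometric_rv Y rho ->
  ('E_Q[fun w => (Y w `^ b)%R] =
   \sum_(0 <= k <oo) (k%:R `^ b * ((1 - rho) * rho ^+ k))%:E)%E.
Proof.
move=> rho01 Ygeom.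
have mY : measurable_fun setT Y by exact: measurable_funPT.
pose F k := [set w | Y w = k%:R].
have mF k : measurable (F k).
  by rewrite -[F k]setTI; exact: (mY measurableT [set k%:R]).
have tF : trivIset setT F.
  apply: ltn_trivIset => k l kl; apply/seteqP; split => // w [].
  by rewrite /F /= => -> /eqP; rewrite eqr_nat ltn_eqF.
have QU : Q (~` \bigcup_k F k) = 0.
  rewrite probability_setC; last exact: bigcup_measurable.
  rewrite measure_semi_bigcup//; last exact: bigcup_measurable.
  rewrite (@eq_eseriesr _ _ (fun k => (1 - rho)%:E * (rho ^+ k)%:E)%E);
    last first.
    by move=> k _; rewrite -EFinM; exact: Ygeom.
  have [rho0 rho1] := andP rho01.
  rewrite nneseriesZl; last by move=> k _; rewrite lee_fin exprn_ge0.
  rewrite nneseries_geometric// -EFinM divff ?subee//.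
  by rewrite subr_eq0 gt_eqF.
rewrite unlock (@integral_countable_values _ _ _ Q _ _ F
  (fun k => (k%:R `^ b)%:E)) //.
- by apply: eq_eseriesr => k _; rewrite EFinM; congr (_ * _)%E; rewrite -Ygeom.
- apply/measurable_EFinP; exact: (measurableT_comp (measurable_powR b) mY).
- by move=> w _; rewrite lee_fin powR_ge0.
- by rewrite setTD; exact: QU.
- by move=> k w; rewrite /F /= => ->.
Qed.

Theorem corollary5p1
  (R : realType) (C : pointedType) (finC : finite_set [set: C])
  (P : probability (Omega C) R)
  (Pinv : shift_invariant P)
  (Psymb : forall s : C, (0 < P (Xcoord 0 @^-1` [set s]))%E)
  (n : nat) (n_gt0 : (0 < n)%N) (a : n.-tuple C)
  (PA_gt0 : (0 < P (cylinder a))%E)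
  (Pret_gt0 : forall i : nat, (1 <= i)%N -> (0 < P (return_event a i))%E)
  (rho : R) (rho01 : 0 <= rho < 1)
  (d : nat -> R) (d_cvg0 : d @ \oo --> (0 : R))
  (rho_d : forall i : nat, (1 <= i)%N -> `|return_prob P a i - rho| <= d i)
  (dbar : R) (dbarE : dbar = sup [set d i | i in [set i : nat | (1 <= i)%N]])
  (c : R) (c01 : 0 <= c < 1)
  (c_bound : forall k : nat,
     `|cond_prob P (cylinder a) [set x | sojourn R a x = k%:R%:E]
        - (1 - rho) * rho ^+ k|
       <= c ^+ k * (\sum_(1 <= i < k.+2) d i)
       <= c ^+ k * k.+1%:R * dbar)
  (disp : measure_display) (T : measurableType disp) (Q : probability T R)
  (Y : {RV Q >-> R}) (Ygeom : geometric_rv Y rho)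
  (beta : R) (beta_gt0 : 0 < beta) :
  (`| cond_mean P (cylinder a) (fun x => sojourn R a x `^ beta)
      - 'E_Q[fun w => (Y w `^ beta)%R] |
   <= (2 * dbar)%:E
      * \sum_(1 <= k <oo) ((k%:R `^ (beta + 1) * c ^+ k)%R)%:E)%E.
Proof.
have [rho0 rho1] := andP rho01; have [c0 c1] := andP c01.
pose p k := cond_prob P (cylinder a) [set x | sojourn R a x = k%:R%:E].
have p0 k : 0 <= p k by rewrite divr_ge0// fine_ge0.
pose g k := (1 - rho) * rho ^+ k.
have g0 k : 0 <= g k by rewrite mulr_ge0 ?exprn_ge0 ?subr_ge0 ?(ltW rho1).
have pg k : `|p k - g k| <= c ^+ k * k.+1%:R * dbar.
  by have /andP[h1 h2] := c_bound k; exact: le_trans h1 h2.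
(* The hypothesis at [k = 0], where [c ^ 0 = 1] even if [c = 0]. *)
have dbar0 : 0 <= dbar.
  by have := le_trans (normr_ge0 _) (pg 0%N); rewrite expr0 !mul1r.
rewrite cond_mean_sojourn; last exact: infinite_repeats_null rho1 d_cvg0 rho_d.
rewrite (expectation_geometric_powR _ rho01 Ygeom).
apply: (@le_trans _ _ (\sum_(0 <= k <oo)
    (k%:R `^ beta * (c ^+ k * k.+1%:R * dbar))%:E)%E).
  apply: nneseries_dist.
  - by move=> k; rewrite mulr_ge0// ?powR_ge0// p0.
  - by move=> k; rewrite mulr_ge0// ?powR_ge0// g0.
  - by move=> k; rewrite -mulrBr normrM ger0_norm ?powR_ge0//
      ler_wpM2l ?powR_ge0// pg.
  under eq_eseriesr => k _ do rewrite mulrCA EFinM.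
  rewrite nneseriesZl; last first.
    by move=> k _; rewrite lee_fin mulr_ge0 ?powR_ge0 ?exprn_ge0.
  by apply: lte_mul_pinfty; rewrite ?lee_fin ?subr_ge0 ?(ltW rho1)//;
    exact: nneseries_powR_geometric_lty.
(* Both series now run from [k = 1], as the left one has a null first term. *)
rewrite nneseries_recl//; last first.
  by move=> k _; rewrite lee_fin !mulr_ge0 ?powR_ge0 ?exprn_ge0.
rewrite powR0 ?gt_eqF// mul0r add0e -nneseriesZl; last first.
  by move=> k _; rewrite lee_fin mulr_ge0 ?powR_ge0 ?exprn_ge0.
rewrite eseries_cond [leRHS]eseries_cond.
apply: lee_nneseries => k /=.
  by move=> _ _; rewrite lee_fin !mulr_ge0 ?powR_ge0 ?exprn_ge0.
move=> k1; rewrite -EFinM lee_fin.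
have k0 : (0 : R) < k%:R by rewrite ltr0n.
have -> : k%:R `^ (beta + 1) = k%:R `^ beta * k%:R :> R.
  by rewrite powRD ?powRr1 ?(ltW k0)// (gt_eqF k0) implybT.
have -> : 2 * dbar * (k%:R `^ beta * k%:R * c ^+ k) =
    k%:R `^ beta * (c ^+ k * (k%:R *+ 2) * dbar) by ring.
rewrite ler_wpM2l ?powR_ge0// ler_wpM2r// ler_wpM2l ?exprn_ge0//.
by rewrite -mulrnA ler_nat; lia.
Qed.
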